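(* The variety $\mathcal{V}$ of all lattices (in the signature $\{\wedge,\vee\}$) is not coherent, does not admit right uniform deductive interpolation, and its first-order theory does not have a model completion.
   Context: A variety $\mathcal{V}$ is coherent if every finitely generated subalgebra of a finitely presented member of $\mathcal{V}$ is finitely presented (finitely presented: isomorphic to a quotient of a finitely generated free algebra of $\mathcal{V}$ by a finitely generated congruence). $\Sigma\models_{\mathcal{V}}\varepsilon$ means that every assignment of the variables into any member of $\mathcal{V}$ satisfying all equations in $\Sigma$ satisfies $\varepsilon$. $\mathcal{V}$ admits right uniform deductive interpolation if for any finite disjoint sets of variables $\overline{x},\overline{y}$ (with $\overline{y}$ nonempty, as the signature has no constants) and finite set $\Sigma$ of equations in variables $\overline{x},\overline{y}$, there is a finite set $\Pi$ of equations in variables $\overline{y}$ such that for every equation $\varepsilon$ whose variables lie in $\overline{y}$ and a set $\overline{z}$ disjoint from $\overline{x},\overline{y}$: $\Sigma\models_{\mathcal{V}}\varepsilon\iff\Pi\models_{\mathcal{V}}\varepsilon$. A model completion of a theory $T$ is a theory $T^*\supseteq T$ in the same language such that every model of $T$ embeds into a model of $T^*$ and, for every model $M$ of $T$, $T^*$ together with the quantifier-free diagram of $M$ is a complete theory. *)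

(* Defs.v *)
From HB Require Import structures.
From mathcomp Require Import all_boot.
From mathcomp Require Import boolp classical_sets functions cardinality.

Set Implicit Arguments.
Unset Strict Implicit.
Unset Printing Implicit Defensive.

Local Open Scope classical_set_scope.

Record signature := Signature { symbol : Type; arity : symbol -> nat }.

Record algebra (S : signature) := Algebra {
  carrier :> Type;
  op : forall f : symbol S, ('I_(arity f) -> carrier) -> carrier;
  carrier_inhabited : inhabited carrier }.
Arguments op {S} _ _ _.

Definition is_hom S (A B : algebra S) (h : A -> B) : Prop :=
  forall f (a : 'I_(arity f) -> A), h (op A f a) = op B f (h \o a).

Definition embeds S (A B : algebra S) : Prop :=
  exists h : A -> B, is_hom h /\ injective h.

Definition isomorphic S (A B : algebra S) : Prop :=
  exists h : A -> B, is_hom h /\ bijective h.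

Definition op_closed S (A : algebra S) (B : set A) : Prop :=
  forall f (a : 'I_(arity f) -> A), (forall i, B (a i)) -> B (op A f a).

Record subalgebra S (A : algebra S) := Subalgebra {
  subuniverse : set A;
  subuniverse_closed : op_closed subuniverse;
  subuniverse_nonempty : subuniverse !=set0 }.

Lemma subalgebra_op_subproof S (A : algebra S) (B : subalgebra A)
    f (a : 'I_(arity f) -> {x : A | subuniverse B x}) :
  subuniverse B (op A f (fun i => sval (a i))).
Proof. by apply: subuniverse_closed => i; exact: svalP. Qed.

Lemma subalgebra_inhabited_subproof S (A : algebra S) (B : subalgebra A) :
  inhabited {x : A | subuniverse B x}.
Proof. by case: (subuniverse_nonempty B) => x Bx; split; exists x. Qed.

Definition algebra_of_sub S (A : algebra S) (B : subalgebra A) : algebra S :=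
  @Algebra S {x : A | subuniverse B x}
    (fun f a => exist _ (op A f (fun i => sval (a i)))
                        (subalgebra_op_subproof a))
    (subalgebra_inhabited_subproof B).

Definition fg_subalgebra S (A : algebra S) (B : subalgebra A) : Prop :=
  exists G : set A,
    finite_set G /\ subuniverse B = smallest (@op_closed S A) G.

Definition congruence S (A : algebra S) (theta : set (A * A)) : Prop :=
  [/\ forall a, theta (a, a),
      forall a b, theta (a, b) -> theta (b, a),
      forall a b c, theta (a, b) -> theta (b, c) -> theta (a, c) &
      forall f (a b : 'I_(arity f) -> A),
        (forall i, theta (a i, b i)) -> theta (op A f a, op A f b)].

Definition fg_congruence S (A : algebra S) (theta : set (A * A)) : Prop :=
  exists P : set (A * A),
    finite_set P /\ theta = smallest (@congruence S A) P.

Definition quot S (A : algebra S) (theta : set (A * A)) : Type :=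
  {X : A -> Prop | exists a, X = fun b => theta (a, b)}.

Definition quot_class S (A : algebra S) (theta : set (A * A)) (a : A) :
    quot theta :=
  exist _ (fun b => theta (a, b)) (ex_intro _ a erefl).

Definition quot_repr S (A : algebra S) (theta : set (A * A))
    (X : quot theta) : A := sval (cid (svalP X)).

Lemma quot_inhabited_subproof S (A : algebra S) (theta : set (A * A)) :
  inhabited (quot theta).
Proof. by case: (carrier_inhabited A) => a; split; exact: quot_class a. Qed.

(* The operations act on chosen representatives; when theta is a congruence,
   the result does not depend on the choice. *)
Definition quotient_algebra S (A : algebra S) (theta : set (A * A)) :
    algebra S :=
  @Algebra S (quot theta)
    (fun f X => quot_class theta (op A f (fun i => quot_repr (X i))))
    (quot_inhabited_subproof theta).

Definition free_on S (K : algebra S -> Prop) (X : Type) (F : algebra S)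
    (g : X -> F) : Prop :=
  K F /\ forall (A : algebra S) (v : X -> A), K A ->
    exists! h : F -> A, is_hom h /\ h \o g = v.

Definition finitely_presented S (K : algebra S -> Prop) (A : algebra S) :
    Prop :=
  exists (n : nat) (F : algebra S) (g : 'I_n -> F) (theta : set (F * F)),
    [/\ free_on K g, fg_congruence theta &
        isomorphic A (quotient_algebra theta)].

Definition coherent S (K : algebra S -> Prop) : Prop :=
  forall A : algebra S, K A -> finitely_presented K A ->
  forall B : subalgebra A, fg_subalgebra B ->
    finitely_presented K (algebra_of_sub B).

Inductive term (S : signature) :=
| Var of nat
| App (f : symbol S) of ('I_(arity f) -> term S).
Arguments Var {S} _.

Fixpoint eval S (A : algebra S) (v : nat -> A) (t : term S) : A :=
  match t with
  | Var n => v n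
  | App f a => op A f (fun i => eval v (a i))
  end.

Fixpoint term_vars S (t : term S) : set nat :=
  match t with
  | Var n => [set n]
  | App f a => \bigcup_i term_vars (a i)
  end.

Definition equation S : Type := (term S * term S)%type.

Definition equation_vars S (e : equation S) : set nat :=
  term_vars e.1 `|` term_vars e.2.

Definition satisfies_eq S (A : algebra S) (v : nat -> A) (e : equation S) :
  Prop := eval v e.1 = eval v e.2.

Definition eq_consequence S (K : algebra S -> Prop) (Sigma : set (equation S))
    (e : equation S) : Prop :=
  forall (A : algebra S) (v : nat -> A), K A ->
    (forall d, Sigma d -> satisfies_eq v d) -> satisfies_eq v e.

Definition right_uniform_deductive_interpolation S (K : algebra S -> Prop) :
    Prop :=
  forall (x y : set nat) (Sigma : set (equation S)),
    finite_set x -> finite_set y -> x `&` y = set0 -> y !=set0 ->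
    finite_set Sigma ->
    (forall d, Sigma d -> equation_vars d `<=` x `|` y) ->
  exists Pi : set (equation S),
    [/\ finite_set Pi,
        forall d, Pi d -> equation_vars d `<=` y &
        forall (z : set nat) (e : equation S),
          z `&` (x `|` y) = set0 -> equation_vars e `<=` y `|` z ->
          (eq_consequence K Sigma e <-> eq_consequence K Pi e)].

Inductive formula (S : signature) :=
| FEq of term S & term S
| FBot
| FImp of formula S & formula S
| FAll of nat & formula S.
Arguments FBot {S}.

Definition FNot S (phi : formula S) : formula S := FImp phi FBot.

Definition update (T : Type) (v : nat -> T) (n : nat) (a : T) : nat -> T :=
  fun m => if m == n then a else v m.

Fixpoint sat S (A : algebra S) (v : nat -> A) (phi : formula S) : Prop :=
  match phi with
  | FEq s t => eval v s = eval v t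
  | FBot => False
  | FImp phi1 phi2 => sat v phi1 -> sat v phi2
  | FAll n phi1 => forall a : A, sat (update v n a) phi1
  end.

Fixpoint free_vars S (phi : formula S) : set nat :=
  match phi with
  | FEq s t => term_vars s `|` term_vars t
  | FBot => set0
  | FImp phi1 phi2 => free_vars phi1 `|` free_vars phi2
  | FAll n phi1 => free_vars phi1 `\ n
  end.

Fixpoint quantifier_free S (phi : formula S) : Prop :=
  match phi with
  | FEq _ _ | FBot => True
  | FImp phi1 phi2 => quantifier_free phi1 /\ quantifier_free phi2
  | FAll _ _ => False
  end.

Definition sentence S (phi : formula S) : Prop := free_vars phi = set0.

Definition holds S (A : algebra S) (phi : formula S) : Prop :=
  forall v : nat -> A, sat v phi.

Definition model S (T : set (formula S)) (A : algebra S) : Prop :=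
  forall phi, T phi -> holds A phi.

Definition consequence S (T : set (formula S)) (phi : formula S) : Prop :=
  forall A : algebra S, model T A -> holds A phi.

Definition complete S (T : set (formula S)) : Prop :=
  forall phi, sentence phi -> consequence T phi \/ consequence T (FNot phi).

Definition theory_of S (K : algebra S -> Prop) : set (formula S) :=
  [set phi | sentence phi /\ forall A, K A -> holds A phi].

Definition add_constants (S : signature) (C : Type) : signature :=
  @Signature (symbol S + C)
    (fun f => match f with inl g => arity g | inr _ => 0 end).

Fixpoint lift_term S (C : Type) (t : term S) : term (add_constants S C) :=
  match t with
  | Var n => Var n
  | App f a => @App (add_constants S C) (inl f) (fun i => lift_term C (a i))
  end.

Fixpoint lift_formula S (C : Type) (phi : formula S) :
    formula (add_constants S C) :=
  match phi with
  | FEq s t => FEq (lift_term C s) (lift_term C t)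
  | FBot => FBot
  | FImp phi1 phi2 => FImp (lift_formula C phi1) (lift_formula C phi2)
  | FAll n phi1 => FAll n (lift_formula C phi1)
  end.

Definition name_elements S (M : algebra S) : algebra (add_constants S M) :=
  @Algebra (add_constants S M) M
    (fun f => match f with inl g => op M g | inr c => fun=> c end)
    (carrier_inhabited M).

Definition diagram S (M : algebra S) : set (formula (add_constants S M)) :=
  [set phi | [/\ sentence phi, quantifier_free phi &
                 holds (name_elements M) phi]].
Arguments diagram {S} M _.

(* Consistency of T' together with the diagram of M is not required
   separately: it follows from the embedding of M into a model of T'. *)
Definition model_completion S (T T' : set (formula S)) : Prop :=
  [/\ T' `<=` @sentence S,
      T `<=` T',
      forall M : algebra S, model T M ->
        exists N : algebra S, model T' N /\ embeds M N &
      forall M : algebra S, model T M ->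
        complete ((lift_formula M @` T') `|` diagram M)].

Definition has_model_completion S (T : set (formula S)) : Prop :=
  exists T' : set (formula S), model_completion T T'.

Inductive lattice_symbol := Meet | Join.

Definition lattice_signature : signature :=
  @Signature lattice_symbol (fun=> 2).

Definition binary (A : algebra lattice_signature) (f : lattice_symbol)
    (a b : A) : A :=
  op A f (fun i : 'I_2 => if val i == 0 then a else b).

Definition lattices (A : algebra lattice_signature) : Prop :=
  let meet := binary (A := A) Meet in
  let join := binary (A := A) Join in
  [/\ commutative meet /\ commutative join,
      associative meet /\ associative join,
      idempotent_op meet /\ idempotent_op join,
      forall a b, meet a (join a b) = a &
      forall a b, join a (meet a b) = a].

(* Main.v *)
(* For a, b, c in a lattice put step x = x /\ (c \/ (b /\ (a \/ x))), a monotone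
   map below the identity, and consider the system y <= x <= z, x = step x.
   Eliminating x from it yields the infinitely many conditions y <= step^n z:
   they are necessary, and if they hold, the filter generated by the iterates
   step^n z is a solution in the lattice of filters.  In a suitable lattice the
   iterates descend strictly forever, so y = step^n z satisfies only finitely
   many of the conditions, whereas the class of the sequence (step^n z)_n in an
   ultrapower satisfies them all.  By Los's theorem no finite amount of
   information on y, z, a, b, c alone can express the solvability of the system.
   A finite set Pi of interpolants, or a finite presentation of the subalgebra
   generated by y, z, a, b, c, would be such information; and if T' were a model
   completion, the diagram of an ultrapower of a model of T' would have to
   decide the solvability, which holds in one extension that is a model of T'
   and fails in the ultrapower itself. *)

From mathcomp Require Import all_boot.
From mathcomp Require Import boolp classical_sets functions cardinality filter.
Require Import Defs.

Set Implicit Arguments.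
Unset Strict Implicit.
Unset Printing Implicit Defensive.

Local Open Scope classical_set_scope.

(** * Subset types and filters *)

Lemma sval_inj (T : Type) (P : T -> Prop) : injective (@sval T P).
Proof.
move=> [x Px] [y Py] /= xy; move: Px; rewrite xy => Px.
by congr exist; exact: Prop_irrelevance.
Qed.

Lemma filter_finite_set (T I : Type) (F : set_system T) (P : set I)
    (D : I -> set T) : Filter F -> finite_set P ->
  (forall i, P i -> F (D i)) -> F [set t | forall i, P i -> D i t].
Proof.
move=> FF /(@finite_seqP {classic I})[s ->]; elim: s => [|i s IHs] FD.
  by apply: filterS filterT => t _ i; rewrite /= in_nil.
have Fi : F (D i) by apply: FD; rewrite /= mem_head.
have Fs : F [set t | forall j : {classic I}, j \in s -> D j t].
  by apply: IHs => j js; apply: FD; rewrite /= inE js orbT.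
apply: filterS2 Fi Fs => t Dit Dst j /=.
by rewrite inE => /predU1P[->|/Dst].
Qed.

Lemma nonprincipal_ultrafilter :
  exists U : set_system nat, UltraFilter U /\ forall k, U [set n | k <= n].
Proof.
have [U [UU sub]] := ultraFilterLemma eventually_filter.
by exists U; split=> // k; apply: sub; exists k.
Qed.

(** * Homomorphisms, quotients and formulas *)

Lemma comp_hom S (A B C : algebra S) (h : A -> B) (k : B -> C) :
  is_hom h -> is_hom k -> is_hom (k \o h).
Proof. by move=> hh hk f a; rewrite /= hh hk. Qed.

Lemma eval_hom S (A B : algebra S) (h : A -> B) v t :
  is_hom h -> h (eval v t) = eval (h \o v) t.
Proof.
move=> hh; elim: t => [//|f a IH] /=; rewrite hh; congr op.
by apply/funext => i /=; exact: IH.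
Qed.

Lemma satisfies_hom S (A B : algebra S) (h : A -> B) v e :
  is_hom h -> satisfies_eq v e -> satisfies_eq (h \o v) e.
Proof. by move=> hh; rewrite /satisfies_eq -!eval_hom // => ->. Qed.

Lemma eval_ext S (A : algebra S) (v w : nat -> A) t :
  (forall n, term_vars t n -> v n = w n) -> eval v t = eval w t.
Proof.
elim: t => [n|f a IH] /= vw; first exact: vw.
by congr op; apply/funext => i; apply: IH => n tn; apply: vw; exists i.
Qed.

Lemma sat_ext S (A : algebra S) phi (v w : nat -> A) :
  (forall n, free_vars phi n -> v n = w n) -> sat v phi <-> sat w phi.
Proof.
elim: phi v w => [s t|//|p IHp q IHq|n p IHp] v w /= vw.
- rewrite (@eval_ext _ _ v w s) ?(@eval_ext _ _ v w t) //.
    by move=> n tn; apply: vw; right.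
  by move=> n sn; apply: vw; left.
- have hp := IHp v w (fun n pn => vw n (or_introl pn)).
  have hq := IHq v w (fun n qn => vw n (or_intror qn)).
  by split=> h /hp /h /hq.
- have E a : sat (update v n a) p <-> sat (update w n a) p.
    apply: IHp => m pm; rewrite /update; case: eqP => // mn.
    by apply: vw; split.
  by split=> h a; apply/E.
Qed.

Lemma sat_sentence S (A : algebra S) phi (v w : nat -> A) :
  sentence phi -> sat v phi -> sat w phi.
Proof.
by move=> sp /sat_ext h; apply: h => n; rewrite [free_vars _]sp.
Qed.

Lemma sat_embedding S (A B : algebra S) (h : A -> B) phi v :
  is_hom h -> injective h -> quantifier_free phi ->
  sat v phi <-> sat (h \o v) phi.
Proof.
move=> hh ih; elim: phi v => [s t|//|p IHp q IHq|//] v /=.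
  by move=> _; rewrite -!eval_hom //; split=> [->|/ih].
by move=> [/IHp hp /IHq hq]; split=> H /hp /H /hq.
Qed.

Lemma quot_classE S (A : algebra S) (theta : set (A * A)) a b :
  congruence theta ->
  quot_class theta a = quot_class theta b <-> theta (a, b).
Proof.
move=> [r s t _]; split=> [/(congr1 sval)/= ab|ab].
  by have /= -> := congr1 (@^~ b) ab; exact: r.
apply: sval_inj => /=; apply/funext => c; apply/propext; split.
  by apply: t; exact: s.
exact: t.
Qed.

Lemma quot_reprK S (A : algebra S) (theta : set (A * A)) (X : quot theta) :
  quot_class theta (quot_repr X) = X.
Proof. by apply: sval_inj; rewrite /= /quot_repr; case: cid. Qed.

Lemma quot_class_hom S (A : algebra S) (theta : set (A * A)) :
  congruence theta ->
  @is_hom S A (quotient_algebra theta) (@quot_class S A theta).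
Proof.
move=> ct f a; apply/quot_classE => //; have [_ _ _] := ct; apply=> i.
by apply/quot_classE; rewrite // quot_reprK.
Qed.

Lemma hom_factor S (A B : algebra S) (theta : set (A * A)) (h : A -> B) :
  congruence theta -> is_hom h -> (forall a b, theta (a, b) -> h a = h b) ->
  exists k : quotient_algebra theta -> B,
    is_hom k /\ forall a, k (quot_class theta a) = h a.
Proof.
move=> ct hh th.
have E a : h (quot_repr (quot_class theta a)) = h a.
  by apply: th; apply/quot_classE; rewrite // quot_reprK.
by exists (h \o @quot_repr S A theta); split=> [f X|//]; rewrite /= E hh.
Qed.

Lemma smallest_congruence S (A : algebra S) (P : set (A * A)) :
  congruence (smallest (@congruence S A) P).
Proof.
split=> [a|a b h|a b c h h'|f a b h] M CM; have [[r s t c'] PM] := CM.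
- exact: r.
- exact: s (h M CM).
- exact: t (h M CM) (h' M CM).
- by apply: c' => i; exact: h i M CM.
Qed.

Lemma ker_congruence S (A B : algebra S) (h : A -> B) :
  is_hom h -> congruence [set p | h p.1 = h p.2].
Proof.
move=> hh; split=> [//|a b /= -> //|a b c /= -> //|f a b /= ab].
by rewrite !hh; congr op; apply/funext => i /=.
Qed.

Lemma smallest_congruence_ker S (A B : algebra S) (P : set (A * A))
    (h : A -> B) : is_hom h -> (forall p, P p -> h p.1 = h p.2) ->
  forall a b, smallest (@congruence S A) P (a, b) -> h a = h b.
Proof.
move=> hh Ph a b /(_ [set p | h p.1 = h p.2]); apply; split=> //.
exact: ker_congruence.
Qed.

(** * Ultrapowers *)

Definition power S (A : algebra S) : algebra S :=
  @Algebra S (nat -> A) (fun f a n => op A f (fun i => a i n))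
    (let: inhabits x := carrier_inhabited A in inhabits (fun=> x)).

Definition eq_mod S (A : algebra S) (U : set_system nat) :
    set (power A * power A) :=
  [set p | U [set n | p.1 n = p.2 n]].
Arguments eq_mod {S} A U _.

Lemma eq_mod_congruence S (A : algebra S) U :
  Filter U -> congruence (eq_mod A U).
Proof.
move=> FU; split=> [a|a b|a b c|f a b]; rewrite /eq_mod /=.
- by apply: filterS filterT.
- by apply: filterS => n /= ->.
- by apply: filterS2 => n /= -> ->.
- move=> /filter_forall; apply: filterS => n ab.
  by congr op; apply/funext => i; exact: ab.
Qed.

Definition ultrapower S (A : algebra S) U : algebra S :=
  quotient_algebra (eq_mod A U).

Definition uclass S (A : algebra S) U (w : nat -> A) : ultrapower A U :=
  @quot_class S (power A) (eq_mod A U) w.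
Arguments uclass {S A} U w.

Lemma uclassE S (A : algebra S) U (w w' : nat -> A) : Filter U ->
  uclass U w = uclass U w' <-> U [set n | w n = w' n].
Proof. by move=> FU; apply: quot_classE; exact: eq_mod_congruence. Qed.

Lemma uclass_hom S (A B : algebra S) U (h : nat -> B -> A) : Filter U ->
  (forall n, is_hom (h n)) ->
  @is_hom S B (ultrapower A U) (fun b => uclass U (h ^~ b)).
Proof.
move=> FU hh; have qh := quot_class_hom (eq_mod_congruence A FU).
apply: (comp_hom (B := power A) (h := fun b => h ^~ b)) qh => f a.
by apply/funext => n; rewrite hh.
Qed.

Lemma eval_ultrapower S (A : algebra S) U (w : nat -> nat -> A) t : Filter U ->
  eval (fun m => uclass U (w m)) t = uclass U (fun n => eval (w ^~ n) t).
Proof.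
move=> FU; have qh := quot_class_hom (eq_mod_congruence A FU).
rewrite -(eval_hom (A := power A) w t qh); congr quot_class.
elim: t => [//|f a IH] /=; apply/funext => n.
by congr op; apply/funext => i; rewrite IH.
Qed.

Lemma ultra_not T (U : set_system T) (P : set T) : UltraFilter U ->
  ~ U P -> U (~` P).
Proof. by move=> UU nP; have [] := in_ultra_setVsetC P UU. Qed.

(** Induction on [phi]. The case of an implication rests on [U] containing every set or its
    complement, that of a quantifier on gluing elements chosen index by index into one class. *)
Theorem los S (A : algebra S) U phi (w : nat -> nat -> A) : UltraFilter U ->
  sat (A := ultrapower A U) (fun m => uclass U (w m)) phi <->
  U [set n | sat (w ^~ n) phi].
Proof.
move=> UU; elim: phi w => [s t||p IHp q IHq|m p IHp] w /=.
- by rewrite !eval_ultrapower; exact: uclassE.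
- by split=> // /filter_not_empty.
- rewrite IHp IHq; split=> [H|H Hp]; last first.
    by apply: filterS2 Hp H => n pn; apply.
  have [/H|/ultra_not Np] := EM (U [set n | sat (w ^~ n) p]).
    by apply: filterS => n qn _.
  by apply: filterS Np => n np /np.
- have E a : sat (A := ultrapower A U)
      (update (fun k => uclass U (w k)) m (uclass U a)) p <->
      U [set n | sat (update (w ^~ n) m (a n)) p].
    have -> : update (fun k => uclass U (w k)) m (uclass U a) =
        fun k => uclass U (update w m a k).
      by apply/funext => k; rewrite /update; case: eqP.
    rewrite IHp; suff -> : (fun n => sat (update w m a ^~ n) p) =
        (fun n => sat (update (w ^~ n) m (a n)) p) by [].
    apply/funext => n; congr sat; apply/funext => k.
    by rewrite /update; case: eqP.
  split=> [H|H X]; last first.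
    rewrite -[X]quot_reprK; apply/E; apply: filterS H => n; exact.
  apply: contrapT => /ultra_not Np.
  (* [a n] is a counterexample at every index where there is one, and arbitrary elsewhere. *)
  have /choice[a Ha] : forall n, exists a,
      (~ forall a, sat (update (w ^~ n) m a) p) ->
      ~ sat (update (w ^~ n) m a) p.
    move=> n; have [h|/existsNP[a Ha]] :=
      EM (forall a, sat (update (w ^~ n) m a) p).
      by have [a] := carrier_inhabited A; exists a.
    by exists a.
  have /E Ua := H (uclass U a).
  apply: (@filter_not_empty _ U); apply: filterS2 Ua Np => n /= + /Ha.
  by [].
Qed.

(** * Lattices *)

Definition le (A : algebra lattice_signature) (a b : A) : Prop :=
  binary Meet a b = a.

Lemma op_binary (A : algebra lattice_signature) f (a : 'I_2 -> A) :
  op A f a = binary f (a ord0) (a ord_max).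
Proof.
rewrite /binary; congr op; apply/funext => i.
by case: i => -[|[|//]] /= i2; congr a; exact: val_inj.
Qed.

Lemma hom_binary (A B : algebra lattice_signature) (h : A -> B) f a b :
  is_hom h -> h (binary f a b) = binary f (h a) (h b).
Proof.
move=> hh; rewrite /binary hh; congr op; apply/funext => i /=.
by case: ifP.
Qed.

Lemma binary_hom (A B : algebra lattice_signature) (h : A -> B) :
  (forall f a b, h (binary f a b) = binary f (h a) (h b)) -> is_hom h.
Proof. by move=> hh f a; rewrite !op_binary hh. Qed.

Lemma hom_le (A B : algebra lattice_signature) (h : A -> B) a b :
  is_hom h -> le a b -> le (h a) (h b).
Proof. by move=> hh; rewrite /le -(hom_binary _ _ _ hh) => ->. Qed.

Lemma le_of_hom (A B : algebra lattice_signature) (h : A -> B) a b :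
  is_hom h -> injective h -> le (h a) (h b) -> le a b.
Proof. by move=> hh ih; rewrite /le -(hom_binary _ _ _ hh) => /ih. Qed.

Lemma lattices_image (A B : algebra lattice_signature) (h : A -> B) :
  is_hom h -> (forall b, exists a, h a = b) -> lattices A -> lattices B.
Proof.
move=> hh sh [[mC jC] [mA jA] [mm jj] mj jm].
have hb f a b : binary f (h a) (h b) = h (binary f a b).
  by rewrite hom_binary.
split; [split|split|split|idtac|idtac].
- by move=> b b'; have [[a <-] [a' <-]] := (sh b, sh b'); rewrite !hb mC.
- by move=> b b'; have [[a <-] [a' <-]] := (sh b, sh b'); rewrite !hb jC.
- move=> b b' b''; have [[a <-] [a' <-] [a'' <-]] :=
    And3 (sh b) (sh b') (sh b'').
  by rewrite !hb mA.
- move=> b b' b''; have [[a <-] [a' <-] [a'' <-]] :=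
    And3 (sh b) (sh b') (sh b'').
  by rewrite !hb jA.
- by move=> b; have [a <-] := sh b; rewrite hb mm.
- by move=> b; have [a <-] := sh b; rewrite hb jj.
- by move=> b b'; have [[a <-] [a' <-]] := (sh b, sh b'); rewrite !hb mj.
- by move=> b b'; have [[a <-] [a' <-]] := (sh b, sh b'); rewrite !hb jm.
Qed.

Lemma le_refl (A : algebra lattice_signature) (a : A) :
  lattices A -> le a a.
Proof. by case=> _ _ [mm _] _ _; exact: mm. Qed.

Lemma le_trans (A : algebra lattice_signature) (b a c : A) :
  lattices A -> le a b -> le b c -> le a c.
Proof. by case=> _ [mA _] _ _ _; rewrite /le => ab bc; rewrite -ab -mA bc. Qed.

Lemma le_anti (A : algebra lattice_signature) (a b : A) :
  lattices A -> le a b -> le b a -> a = b.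
Proof. by case=> [[mC _] _ _ _ _]; rewrite /le => ab ba; rewrite -ab mC. Qed.

Lemma le_join (A : algebra lattice_signature) (a b : A) :
  lattices A -> le a b <-> binary Join a b = b.
Proof.
case=> [[mC jC] _ _ mj jm]; rewrite /le; split=> [<-|<-]; last exact: mj.
by rewrite jC mC jm.
Qed.

Lemma meet_glb (A : algebra lattice_signature) (a b c : A) : lattices A ->
  le c (binary Meet a b) <-> le c a /\ le c b.
Proof.
case=> [[mC _] [mA _] [mm _] _ _]; rewrite /le; split=> [<-|[ca cb]].
  split; last by rewrite -!mA mm.
  by rewrite [binary Meet a b]mC !mA -[in LHS]mA mm.
by rewrite mA ca.
Qed.

Lemma join_lub (A : algebra lattice_signature) (a b c : A) : lattices A ->
  le (binary Join a b) c <-> le a c /\ le b c.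
Proof.
move=> LA; have [[_ jC] [_ jA] [_ jj] _ _] := LA.
rewrite !le_join //; split=> [<-|[ac bc]]; last by rewrite -jA bc.
by split; [rewrite !jA jj|rewrite [binary Join a b]jC !jA jj].
Qed.

Lemma le_meet (A : algebra lattice_signature) (a b a' b' : A) :
  lattices A -> le a a' -> le b b' ->
  le (binary Meet a b) (binary Meet a' b').
Proof.
move=> LA aa' bb'.
have [] := (meet_glb a b (binary Meet a b) LA).1 (le_refl _ LA).
move=> ? ?; apply/meet_glb => //.
by split; [exact: le_trans aa'|exact: le_trans bb'].
Qed.

Lemma le_joins (A : algebra lattice_signature) (a b a' b' : A) :
  lattices A -> le a a' -> le b b' ->
  le (binary Join a b) (binary Join a' b').
Proof.
move=> LA aa' bb'.
have [] := (join_lub a' b' (binary Join a' b') LA).1 (le_refl _ LA).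
move=> ? ?; apply/join_lub => //.
by split; [exact: le_trans aa' _|exact: le_trans bb' _].
Qed.

(** * The map [step] and its iterates *)

Definition step (A : algebra lattice_signature) (a b c x : A) : A :=
  binary Meet x (binary Join c (binary Meet b (binary Join a x))).

Lemma step_hom (A B : algebra lattice_signature) (h : A -> B) a b c x :
  is_hom h -> h (step a b c x) = step (h a) (h b) (h c) (h x).
Proof. by move=> hh; rewrite /step !(hom_binary _ _ _ hh). Qed.

Lemma iter_step_hom (A B : algebra lattice_signature) (h : A -> B) a b c z n :
  is_hom h ->
  h (iter n (step a b c) z) = iter n (step (h a) (h b) (h c)) (h z).
Proof. by move=> hh; elim: n => //= n <-; exact: step_hom. Qed.

Lemma step_le (A : algebra lattice_signature) (a b c x : A) :
  lattices A -> le (step a b c x) x.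
Proof.
by move=> LA; have [] := (meet_glb _ _ _ LA).1 (le_refl (step a b c x) LA).
Qed.

Lemma step_mono (A : algebra lattice_signature) (a b c x y : A) :
  lattices A -> le x y -> le (step a b c x) (step a b c y).
Proof.
move=> LA xy; apply: le_meet => //; apply: le_joins (le_refl _ LA) _ => //.
by apply: le_meet (le_refl _ LA) _ => //; apply: le_joins (le_refl _ LA) _.
Qed.

Lemma iter_step_mono (A : algebra lattice_signature) (a b c z : A) k n :
  lattices A -> k <= n ->
  le (iter n (step a b c) z) (iter k (step a b c) z).
Proof.
move=> LA /subnK <-; elim: (n - k) => [|m IH]; first exact: le_refl.
by apply: le_trans IH => //; exact: step_le.
Qed.

(** Applying the monotone map [step] to [x <= step^n z] fixes the left side and advances the right
    side. This gives the necessity of the conditions left after eliminating [x]. *)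
Lemma fixpoint_le_iter (A : algebra lattice_signature) (a b c x z : A) n :
  lattices A -> step a b c x = x -> le x z -> le x (iter n (step a b c) z).
Proof.
move=> LA fx xz; elim: n => [//|n IH] /=; rewrite -fx.
exact: step_mono.
Qed.

(** * Lattices of closed sets *)

Definition lattice_of (T : Type) (meet join : T -> T -> T) (x : T) :
    algebra lattice_signature :=
  @Algebra lattice_signature T
    (fun f => match f return ('I_2 -> T) -> T with
              | Meet => fun a => meet (a ord0) (a ord_max)
              | Join => fun a => join (a ord0) (a ord_max)
              end)
    (inhabits x).

Definition dual (A : algebra lattice_signature) (x : A) :
    algebra lattice_signature :=
  lattice_of (binary (A := A) Join) (binary (A := A) Meet) x.

Lemma dual_lattice (A : algebra lattice_signature) (x : A) :
  lattices A -> lattices (dual x).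
Proof. by case=> [[? ?] [? ?] [? ?] ? ?]. Qed.

Definition Moore_family T (C : set (set T)) : Prop :=
  forall D, D `<=` C -> C (\bigcap_(X in D) X).

Lemma Moore_setI T (C : set (set T)) X Y :
  Moore_family C -> C X -> C Y -> C (X `&` Y).
Proof.
move=> MC CX CY.
have -> : X `&` Y = \bigcap_(Z in [set X; Y]) Z.
  by rewrite bigcap_setU !bigcap_set1.
by apply: MC => Z [->|->].
Qed.

Lemma Moore_smallest T (C : set (set T)) G :
  Moore_family C -> C (smallest C G).
Proof. by move=> MC; apply: MC => X []. Qed.

Definition closed_lattice T (C : set (set T)) (MC : Moore_family C) :
    algebra lattice_signature :=
  @lattice_of {X | C X}
    (fun X Y => exist _ _ (Moore_setI MC (svalP X) (svalP Y)))
    (fun X Y => exist _ _ (Moore_smallest (sval X `|` sval Y) MC))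
    (exist _ _ (Moore_smallest set0 MC)).

Lemma closed_latticeP T (C : set (set T)) (MC : Moore_family C) :
  lattices (closed_lattice MC).
Proof.
have sub_l X Y : X `<=` smallest C (X `|` Y).
  by apply: sub_smallest => t; left.
have sub_r X Y : Y `<=` smallest C (X `|` Y).
  by apply: sub_smallest => t; right.
have lub X Y Z : C Z -> X `<=` Z -> Y `<=` Z -> smallest C (X `|` Y) `<=` Z.
  by move=> CZ XZ YZ; apply: smallest_sub => // t [/XZ|/YZ].
have CS G : C (smallest C G) by exact: Moore_smallest.
split; [split|split|split|idtac|idtac].
- by move=> X Y; apply: sval_inj; exact: setIC.
- by move=> X Y; apply: sval_inj; rewrite /= setUC.
- by move=> X Y Z; apply: sval_inj; exact: setIA.
- move=> [X CX] [Y CY] [Z CZ]; apply: sval_inj => /=.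
  apply/seteqP; split; apply: (lub) => //.
  + exact: subset_trans (sub_l _ _) (sub_l _ _).
  + apply: (lub) => //; apply: subset_trans (sub_r _ _) _; exact: sub_l.
  + apply: (lub) => //; apply: subset_trans (sub_l _ _) _; exact: sub_r.
  + exact: subset_trans (sub_r _ _) (sub_r _ _).
- by move=> X; apply: sval_inj; exact: setIid.
- by move=> [X CX]; apply: sval_inj; rewrite /= setUid smallest_id.
- by move=> [X CX] [Y CY]; apply: sval_inj; apply: setIidl; exact: sub_l.
- move=> [X CX] [Y CY]; apply: sval_inj; apply/seteqP; split=> /=.
    by apply: (lub) => //; exact: subIsetl.
  exact: sub_l.
Qed.

(** * A lattice in which the iterates of [step] descend forever *)

(** The points form one infinite chain [P 0], [Q 0], [P 1], [Q 1], and so on, in which [PA] and [PC]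
    enable the two kinds of links. *)
Inductive point := PA | PC | P of nat | Q of nat.

(* In a closed set, a turns P n into Q n and c turns Q n into P n.+1. *)
Definition point_closed (X : set point) : Prop :=
  (forall n, X PA -> X (P n) -> X (Q n)) /\
  (forall n, X PC -> X (Q n) -> X (P n.+1)).

Lemma point_closed_Moore : Moore_family point_closed.
Proof.
move=> D DC; split=> n H H' X DX; have [c1 c2] := DC _ DX.
  exact: c1 (H X DX) (H' X DX).
exact: c2 (H X DX) (H' X DX).
Qed.

(** Among the closed sets let [a = {PA}], [c = {PC}], let [b] consist of all [Q k], and let [X n]
    consist of the [P k] with [k >= n]. Joining [a] to [X n] adds the [Q k] with [k >= n], meeting
    with [b] keeps only these, joining [c] adds the [P k.+1], and meeting with [X n] leaves
    [X n.+1], which lacks [P n]. *)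
Lemma descending_lattice : exists (L : algebra lattice_signature) (a b c z : L),
  lattices L /\
  forall n, ~ le (iter n (step a b c) z) (iter n.+1 (step a b c) z).
Proof.
have cA : point_closed [set PA] by [].
have cB : point_closed [set x | exists n, x = Q n] by split=> n [] // ? [].
have cC : point_closed [set PC] by [].
have cX n : point_closed [set x | exists2 k, n <= k & x = P k].
  by split=> m [] // ? [].
pose L := closed_lattice point_closed_Moore.
pose X n : L := exist _ _ (cX n).
pose a : L := exist _ _ cA; pose b : L := exist _ _ cB.
pose c : L := exist _ _ cC.
exists L, a, b, c, (X 0); split; first exact: closed_latticeP.
(* This closed set and the next one bound from above the two joins occurring in
   [step a b c (X n)]. *)
have cAX n : point_closed
    [set x | x = PA \/ exists2 k, n <= k & x = P k \/ x = Q k].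
  split=> m /=; last by case=> [|[? _ []]].
  by move=> _ [//|[k nk [[->]|//]]]; right; exists k => //; right.
have cCX n : point_closed
    [set x | x = PC \/ exists2 k, n <= k & x = Q k \/ x = P k.+1].
  split=> m /=; first by case=> [|[? _ []]].
  by move=> _ [//|[k nk [[->]|//]]]; right; exists k => //; right.
have stepX n : step a b c (X n) = X n.+1.
  apply: sval_inj; apply/seteqP; split=> /= x.
    move=> [[k nk ->]] /(_ _ (conj (cCX n) _))[].
    - move=> y [->|[[j ->]]]; first by left.
      move=> /(_ _ (conj (cAX n) _))[]//.
        by move=> w [->|[i ni ->]]; [left|right; exists i => //; left].
      by move=> [i ni [//|->]]; right; exists i => //; left.
    - by [].
    - by move=> [i ni [//|[->]]]; exists i.+1.
  (* Conversely, every closed set containing the joined sets derives [Q k] from [P k] by means of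
     [PA], then [P k.+1] from [Q k] by means of [PC]. *)
  move=> [[//|k] nk ->]; split; first by exists k.+1; rewrite // ltnW.
  move=> M [[_ M2] sM]; apply: M2; first by apply: sM; left.
  apply: sM; right; split; first by exists k.
  move=> M' [[M1 _] sM']; apply: M1; apply: sM'; first by left.
  by right; exists k.
move=> n; rewrite iterS.
have -> : iter n (step a b c) (X 0) = X n
  by elim: (n) => //= m ->; exact: stepX.
rewrite stepX => /(congr1 sval)/= H.
have : [set x | exists2 k, n <= k & x = P k] (P n) by exists n.
by rewrite -H => -[_ [k nk [E]]]; move: nk; rewrite -E ltnn.
Qed.

(** * Adjoining a fixpoint *)

(** The empty set counts as a filter, so filters are closed under arbitrary intersection even when
    the lattice has no top. *)
Definition is_filter (M : algebra lattice_signature) (F : set M) : Prop :=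
  (forall a b, F a -> le a b -> F b) /\
  (forall a b, F a -> F b -> F (binary Meet a b)).

Lemma is_filter_Moore M : Moore_family (@is_filter M).
Proof.
move=> D DF; split=> a b H H'; last first.
  by move=> X DX; apply: (DF X DX).2; [exact: H|exact: H'].
by move=> X DX; apply: (DF X DX).1 H'; exact: H.
Qed.

(** The dual is taken because principal filters shrink as their generators grow: under reverse
    inclusion, passing to principal filters preserves the order. *)
Definition filter_lattice (M : algebra lattice_signature) :
    algebra lattice_signature :=
  let C := closed_lattice (@is_filter_Moore M) in
  dual (A := C) (exist _ _ (Moore_smallest set0 (@is_filter_Moore M))).

(** For a decreasing [f] this is the filter generated by the values of [f]; constant sequences give
    the principal filters. *)
Definition upset (M : algebra lattice_signature) (f : nat -> M) : set M :=
  [set m | exists k, le (f k) m].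

Definition decreasing (M : algebra lattice_signature) (f : nat -> M) : Prop :=
  forall k n, k <= n -> le (f n) (f k).

Lemma upset_filter (M : algebra lattice_signature) (f : nat -> M) :
  lattices M -> decreasing f -> is_filter (upset f).
Proof.
move=> LM df; split=> [a b [k ka] ab|a b [k ka] [n nb]].
  by exists k; exact: le_trans ab.
exists (maxn k n); apply/meet_glb => //; split.
  by apply: le_trans ka => //; apply: df; exact: leq_maxl.
by apply: le_trans nb => //; apply: df; exact: leq_maxr.
Qed.

Lemma decreasing_binary (M : algebra lattice_signature) s (f g : nat -> M) :
  lattices M -> decreasing f -> decreasing g ->
  decreasing (fun k => binary s (f k) (g k)).
Proof.
move=> LM df dg k n kn; have [fkn gkn] := (df k n kn, dg k n kn).
by case: s; [exact: le_meet|exact: le_joins].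
Qed.

(** Since the sequences decrease, bounds found at two indices both hold at their maximum, so filters
    can be combined termwise on their generating sequences. This reduces computing [step] on filters
    to computing it in [M]. *)
Lemma filter_lattice_binary (M : algebra lattice_signature) s
    (X Y : filter_lattice M) (f g : nat -> M) :
  lattices M -> decreasing f -> decreasing g ->
  sval X = upset f -> sval Y = upset g ->
  sval (binary s X Y) = upset (fun k => binary s (f k) (g k)).
Proof.
move=> LM df dg Xf Yg; have dfg := decreasing_binary s LM df dg.
have lb k : le (binary Meet (f k) (g k)) (f k) /\
    le (binary Meet (f k) (g k)) (g k).
  by apply/meet_glb; [|exact: le_refl].
case: s dfg => dfg /=; rewrite Xf Yg; apply/seteqP; split.
- apply: smallest_sub; first exact: upset_filter.
  move=> m [] [k fm]; exists k; apply: le_trans fm => //; first exact: (lb k).1.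
  exact: (lb k).2.
- move=> m [k fgm] F [[up cap] FX]; apply: up fgm; apply: cap; apply: FX.
    by left; exists k; exact: le_refl.
  by right; exists k; exact: le_refl.
- move=> m [[k fm] [n gm]]; exists (maxn k n); apply/join_lub => //; split.
    by apply: le_trans fm => //; apply: df; exact: leq_maxl.
  by apply: le_trans gm => //; apply: dg; exact: leq_maxr.
- by move=> m [k /join_lub-/(_ LM)[fm gm]]; split; exists k.
Qed.

Theorem fixpoint_extension (M : algebra lattice_signature) (a b c y z : M) :
  lattices M -> (forall k, le y (iter k (step a b c) z)) ->
  exists (M' : algebra lattice_signature) (h : M -> M') (x : M'),
    [/\ lattices M', is_hom h, injective h &
        [/\ le (h y) x, le x (h z) & x = step (h a) (h b) (h c) x]].
Proof.
move=> LM yz.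
have const m : @decreasing M (fun=> m) by move=> *; exact: le_refl.
pose g k := iter k (step a b c) z.
have df : decreasing g.
  by move=> k n; exact: iter_step_mono.
pose h m : filter_lattice M := exist _ _ (upset_filter LM (const m)).
pose x : filter_lattice M := exist _ _ (upset_filter LM df).
have LF : lattices (filter_lattice M).
  by apply: dual_lattice; exact: closed_latticeP.
exists (filter_lattice M), h, x; split=> //.
- apply: binary_hom => s m m'; apply: sval_inj.
  by rewrite (@filter_lattice_binary M _ _ _ (fun=> m) (fun=> m')).
- move=> m m' /(congr1 sval)/= E; apply: le_anti => //.
    have : upset (fun=> m') m' by exists 0; exact: le_refl.
    by rewrite -E => -[].
  have : upset (fun=> m) m by exists 0; exact: le_refl.
  by rewrite E => -[].
split.
- apply: sval_inj.
  (* The hypothesis makes the termwise meet of [y] with the iterates constantly [y]. *)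
  rewrite (@filter_lattice_binary M _ _ _ (fun=> y) g) //=.
  by congr upset; apply/funext => k; exact: yz.
- apply: sval_inj.
  rewrite (@filter_lattice_binary M _ _ _ g (fun=> z)) //=.
  by congr upset; apply/funext => k; exact: (iter_step_mono _ _ _ _ LM (leq0n k)).
- have E : sval (step (h a) (h b) (h c) x) = upset (fun k => step a b c (g k)).
    by do !(apply: filter_lattice_binary => //; do ?apply: decreasing_binary).
  (* [step] shifts the sequence of iterates by one place, and a decreasing sequence generates the
     same filter as its shift. *)
  apply: sval_inj; rewrite E; apply/seteqP; split=> m [k km]; last by exists k.+1.
  by exists k; apply: le_trans km => //; exact: step_le.
Qed.

(** * The equations [y <= x <= z], [x = step x] *)

Definition bin_term s (t1 t2 : term lattice_signature) :
    term lattice_signature :=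
  @App lattice_signature s (fun i => if val i == 0 then t1 else t2).

Lemma eval_bin (A : algebra lattice_signature) (v : nat -> A) s t1 t2 :
  eval v (bin_term s t1 t2) = binary s (eval v t1) (eval v t2).
Proof. by rewrite /= op_binary. Qed.

Lemma bin_term_vars s t1 t2 (X : set nat) :
  term_vars t1 `<=` X -> term_vars t2 `<=` X ->
  term_vars (bin_term s t1 t2) `<=` X.
Proof. by move=> X1 X2 n [i _] /=; case: ifP => _; [exact: X1|exact: X2]. Qed.

Definition le_eq t1 t2 : equation lattice_signature :=
  (bin_term Meet t1 t2, t1).

Lemma satisfies_le (A : algebra lattice_signature) (v : nat -> A) t1 t2 :
  satisfies_eq v (le_eq t1 t2) = le (eval v t1) (eval v t2).
Proof. by rewrite /satisfies_eq eval_bin. Qed.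

Lemma le_eq_vars t1 t2 (X : set nat) : term_vars t1 `<=` X ->
  term_vars t2 `<=` X -> equation_vars (le_eq t1 t2) `<=` X.
Proof.
by move=> X1 X2 n [|]; [exact: bin_term_vars|exact: X1].
Qed.

(* Throughout, the variables 0, ..., 5 stand for x, y, z, a, b, c. *)
Definition step_term (t : term lattice_signature) : term lattice_signature :=
  bin_term Meet t
    (bin_term Join (Var 5) (bin_term Meet (Var 4) (bin_term Join (Var 3) t))).

Lemma eval_step (A : algebra lattice_signature) (v : nat -> A) t :
  eval v (step_term t) = step (v 3) (v 4) (v 5) (eval v t).
Proof. by rewrite /step_term !eval_bin. Qed.

Lemma eval_iter_step (A : algebra lattice_signature) (v : nat -> A) t n :
  eval v (iter n step_term t) =
  iter n (step (v 3) (v 4) (v 5)) (eval v t).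
Proof. by elim: n => // n IH; rewrite iterS eval_step IH. Qed.

Lemma step_term_vars t (X : set nat) : X 3 -> X 4 -> X 5 ->
  term_vars t `<=` X -> term_vars (step_term t) `<=` X.
Proof.
move=> X3 X4 X5 Xt.
have sub n : X n -> term_vars (Var n) `<=` X by move=> Xn m ->.
apply: (bin_term_vars Xt); apply: bin_term_vars; first exact: sub.
by apply: bin_term_vars; [exact: sub|apply: bin_term_vars => //; exact: sub].
Qed.

Lemma iter_step_term_vars t (X : set nat) n : X 3 -> X 4 -> X 5 ->
  term_vars t `<=` X -> term_vars (iter n step_term t) `<=` X.
Proof. by move=> *; elim: n => // n IH; rewrite iterS; exact: step_term_vars. Qed.

Definition fixpoint_eqs : set (equation lattice_signature) :=
  [set le_eq (Var 1) (Var 0); le_eq (Var 0) (Var 2);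
       (step_term (Var 0), Var 0)].

Definition below_iterate n : equation lattice_signature :=
  le_eq (Var 1) (iter n step_term (Var 2)).

Lemma satisfies_below_iterate (A : algebra lattice_signature)
    (v : nat -> A) n :
  satisfies_eq v (below_iterate n) =
  le (v 1) (iter n (step (v 3) (v 4) (v 5)) (v 2)).
Proof. by rewrite satisfies_le eval_iter_step. Qed.

Definition fixpoint_val (A : algebra lattice_signature) (v : nat -> A) : Prop :=
  [/\ le (v 1) (v 0), le (v 0) (v 2) & step (v 3) (v 4) (v 5) (v 0) = v 0].

Lemma fixpoint_val_below (A : algebra lattice_signature) (v : nat -> A) n :
  lattices A -> fixpoint_val v -> satisfies_eq v (below_iterate n).
Proof.
move=> LA [yx xz fx]; rewrite satisfies_below_iterate.
by apply: le_trans yx _ => //; exact: fixpoint_le_iter.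
Qed.

Lemma fixpoint_val_hom (A B : algebra lattice_signature) (h : A -> B)
    (v : nat -> A) : is_hom h -> fixpoint_val v -> fixpoint_val (h \o v).
Proof.
move=> hh [yx xz fx]; split; [exact: hom_le|exact: hom_le|].
by rewrite /= -step_hom // fx.
Qed.

(** The default value of [nth] gives [c] to variable 5 and to all later ones. *)
Definition assign (T : Type) (x y z a b c : T) : nat -> T :=
  nth c [:: x; y; z; a; b].

(** * Ultrapowers of lattices and the limit of the iterates *)

Lemma lattices_power (A : algebra lattice_signature) :
  lattices A -> lattices (power A).
Proof.
case=> [[mC jC] [mA jA] [mm jj] mj jm].
have E s (f g : power A) : binary s f g = fun n => binary s (f n) (g n).
  by apply/funext => n; rewrite /binary /=; congr op; apply/funext => i; case: ifP.
split; [split|split|split|idtac|idtac] => f; move=> *; rewrite !E;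
  apply/funext => n; rewrite ?E.
- exact: mC.
- exact: jC.
- exact: mA.
- exact: jA.
- exact: mm.
- exact: jj.
- exact: mj.
- exact: jm.
Qed.

Lemma lattices_ultrapower (A : algebra lattice_signature) U : Filter U ->
  lattices A -> lattices (ultrapower A U).
Proof.
move=> FU /lattices_power; apply: (@lattices_image (power A)).
  exact: quot_class_hom (eq_mod_congruence A FU).
by move=> X; exists (quot_repr X); exact: quot_reprK.
Qed.

(** Variable 0, the unknown [x], receives [y] as a placeholder; this agrees with the redirection of
    [x] to [y] in the proof of incoherence. *)
Definition iterate_val (A : algebra lattice_signature) (a b c z : A) n :
    nat -> A :=
  let y := iter n (step a b c) z in assign y y z a b c.

Definition limit_val (A : algebra lattice_signature) (a b c z : A) U :
    nat -> ultrapower A U :=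
  fun m => uclass U (iterate_val a b c z ^~ m).

(* The ultrapower element [y] represented by the sequence of iterates lies
   below all the iterates, so a fixpoint can be adjoined above it, although
   no fixpoint lies above any member of the sequence. *)
Theorem limit_extension (A : algebra lattice_signature) (a b c z : A) U :
  lattices A -> UltraFilter U -> (forall k, U [set n | k <= n]) ->
  exists (M : algebra lattice_signature) (h : ultrapower A U -> M)
    (v : nat -> M),
    [/\ lattices M, is_hom h, injective h & fixpoint_val v /\
        forall m, m != 0 -> v m = h (limit_val a b c z U m)].
Proof.
move=> LA UU Uk; have LU := lattices_ultrapower (@ultra_proper _ _ UU) LA.
set u := limit_val a b c z U.
(* At index [n] this inequality compares the iterates [n] and [k]; it holds once [k <= n], hence on
   a member of [U]. *)
have below k : le (u 1) (iter k (step (u 3) (u 4) (u 5)) (u 2)).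
  rewrite -satisfies_below_iterate.
  apply/(@los _ A U (FEq (below_iterate k).1 (below_iterate k).2)).
  apply: filterS (Uk k) => n /= kn.
  by rewrite -[_ = _]/(satisfies_eq _ (below_iterate k)) satisfies_below_iterate
    /=; exact: iter_step_mono.
have [M [h [x [LM hh ih [yx xz fx]]]]] := fixpoint_extension LU below.
exists M, h, (fun m => if m == 0 then x else h (u m)).
by split=> //; split=> // -[].
Qed.

(** * Failure of right uniform deductive interpolation *)

Lemma fixpoint_eqsP (A : algebra lattice_signature) (v : nat -> A) :
  (forall e, fixpoint_eqs e -> satisfies_eq v e) <-> fixpoint_val v.
Proof.
split=> [H|[yx xz fx] e [[->|->]|->]]; first split.
- by rewrite -[le _ _](satisfies_le v (Var 1) (Var 0)); apply: H; left; left.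
- by rewrite -[le _ _](satisfies_le v (Var 0) (Var 2)); apply: H; left; right.
- exact: etrans (esym (eval_step v (Var 0))) (H _ (or_intror erefl)).
- by rewrite satisfies_le.
- by rewrite satisfies_le.
- exact: etrans (eval_step v (Var 0)) fx.
Qed.

Theorem lattices_no_right_uniform_interpolation : ~ right_uniform_deductive_interpolation lattices.
Proof.
have [U [UU Uk]] := nonprincipal_ultrafilter.
have [L [a [b [c [z [LL descL]]]]]] := descending_lattice.
(* Only the variable 0, the fixpoint, is eliminated; the extra set of variables will be empty. *)
move=> /(_ [set 0] [set n | 0 < n <= 5] fixpoint_eqs).
case=> //.
- by apply: (@sub_finite_set _ _ `I_6) => // n /= /andP[].
- by apply/seteqP; split=> // n [/= ->].
- by exists 1.
- by rewrite /fixpoint_eqs; do ?[rewrite finite_setU; split].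
- have sub n : n <= 5 -> term_vars (@Var lattice_signature n) `<=`
      [set 0] `|` [set n | 0 < n <= 5].
    by move=> n5 _ ->; case: n n5 => [|n] n5; [left|right].
  move=> d [[->|->]|->].
  + by apply: le_eq_vars; exact: sub.
  + by apply: le_eq_vars; exact: sub.
  + move=> n [|]; last exact: sub.
    by apply: step_term_vars; [right|right|right|exact: sub].
move=> Pi [finPi varsPi /(_ set0)]; rewrite set0I => /(_ _ erefl) PiE.
have [M [h [v [LM hh ih [fv vE]]]]] := limit_extension a b c z LL UU Uk.
(* An equation of [Pi] follows from the system, so it holds in the extension [M]. It does not
   mention variable 0, so injectivity of [h] pulls it back to the ultrapower, and Los's theorem to
   almost all indices. *)
have vPi d : Pi d -> U [set n | satisfies_eq (iterate_val a b c z n) d].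
  move=> Pd; have dv : equation_vars d `<=` [set n | 0 < n <= 5] := varsPi d Pd.
  apply/(@los _ L U (FEq d.1 d.2)) => /=; apply: ih; rewrite !eval_hom //.
  have : satisfies_eq v d.
    apply: (PiE d _).2 LM _; first by move=> n /dv; left.
      by move=> A w LA; apply.
    exact/fixpoint_eqsP.
  rewrite /satisfies_eq; have E t : term_vars t `<=` [set n | 0 < n <= 5] ->
      eval v t = eval (h \o limit_val a b c z U) t.
    by move=> ht; apply: eval_ext => n /ht/andP[n0 _]; rewrite vE // -lt0n.
  rewrite !E // => n dn; apply: dv; [by right|by left].
(* As [Pi] is finite, a single index satisfies all of it. There [y] is the iterate [n], while [Pi]
   must entail that [y] is below the iterate [n.+1]. *)
have [n Pin] := filter_ex (filter_finite_set (@ultra_proper _ _ UU) finPi vPi).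
apply: (descL n); rewrite -/(iterate_val a b c z n 1).
have : satisfies_eq (iterate_val a b c z n) (below_iterate n.+1).
  apply: (PiE _ _).1 LL Pin.
    apply: le_eq_vars; first by move=> _ ->; left.
    by apply: iter_step_term_vars; [left|left|left|move=> _ ->; left].
  by move=> A w LA /fixpoint_eqsP; exact: fixpoint_val_below.
by rewrite satisfies_below_iterate.
Qed.

(** * Model completions *)

Lemma model_theory_lattices (A : algebra lattice_signature) :
  model (theory_of lattices) A <-> lattices A.
Proof.
split=> [AT|LA phi [_]]; last exact.
(* The universal closure of an identity in the variables 0, 1, 2 that is valid in all lattices is a
   sentence of the theory, hence true in [A]. *)
have law t1 t2 :
    term_vars t1 `<=` [set n | n < 3] -> term_vars t2 `<=` [set n | n < 3] ->
    (forall (B : algebra lattice_signature) (v : nat -> B), lattices B ->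
      eval v t1 = eval v t2) ->
    forall a b c : A, eval (update (update (update (fun=> a) 0 a) 1 b) 2 c) t1 =
      eval (update (update (update (fun=> a) 0 a) 1 b) 2 c) t2.
  move=> v1 v2 t12 a b c.
  apply: (AT (FAll 0 (FAll 1 (FAll 2 (FEq t1 t2)))) _ (fun=> a)).
  split; last by move=> B LB v x y z; exact: t12.
  apply/seteqP; split=> // n [[[tn n2] n1] n0].
  have : n < 3 by case: tn => [/v1|/v2].
  by move: n0 n1 n2; case: (n) => [|[|[|m]]] /= n0 n1 n2.
pose x := @Var lattice_signature 0; pose y := @Var lattice_signature 1.
pose z := @Var lattice_signature 2.
have xX : term_vars x `<=` [set n | n < 3] by move=> _ ->.
have yX : term_vars y `<=` [set n | n < 3] by move=> _ ->.
have zX : term_vars z `<=` [set n | n < 3] by move=> _ ->.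
split; [split|split|split|idtac|idtac].
- move=> a b; have := law (bin_term Meet x y) (bin_term Meet y x) _ _ _ a b b.
  rewrite !eval_bin; apply; do ?exact: bin_term_vars.
  by move=> B v [[mC _] _ _ _ _]; rewrite !eval_bin mC.
- move=> a b; have := law (bin_term Join x y) (bin_term Join y x) _ _ _ a b b.
  rewrite !eval_bin; apply; do ?exact: bin_term_vars.
  by move=> B v [[_ jC] _ _ _ _]; rewrite !eval_bin jC.
- move=> a b c.
  have := law (bin_term Meet x (bin_term Meet y z))
    (bin_term Meet (bin_term Meet x y) z) _ _ _ a b c.
  rewrite !eval_bin; apply; do ?by do ?apply: bin_term_vars.
  by move=> B v [_ [mA _] _ _ _]; rewrite !eval_bin mA.
- move=> a b c.
  have := law (bin_term Join x (bin_term Join y z))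
    (bin_term Join (bin_term Join x y) z) _ _ _ a b c.
  rewrite !eval_bin; apply; do ?by do ?apply: bin_term_vars.
  by move=> B v [_ [_ jA] _ _ _]; rewrite !eval_bin jA.
- move=> a; have := law (bin_term Meet x x) x _ _ _ a a a.
  rewrite !eval_bin; apply; do ?exact: bin_term_vars; first by [].
  by move=> B v [_ _ [mm _] _ _]; rewrite !eval_bin mm.
- move=> a; have := law (bin_term Join x x) x _ _ _ a a a.
  rewrite !eval_bin; apply; do ?exact: bin_term_vars; first by [].
  by move=> B v [_ _ [_ jj] _ _]; rewrite !eval_bin jj.
- move=> a b; have := law (bin_term Meet x (bin_term Join x y)) x _ _ _ a b b.
  rewrite !eval_bin; apply; do ?by do ?apply: bin_term_vars.
  by move=> B v [_ _ _ mj _]; rewrite !eval_bin mj.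
- move=> a b; have := law (bin_term Join x (bin_term Meet x y)) x _ _ _ a b b.
  rewrite !eval_bin; apply; do ?by do ?apply: bin_term_vars.
  by move=> B v [_ _ _ _ jm]; rewrite !eval_bin jm.
Qed.

(** * Expansions by constants and diagrams *)

Definition expand S (M N : algebra S) (h : M -> N) :
    algebra (add_constants S M) :=
  @Algebra (add_constants S M) N
    (fun f => match f with inl g => op N g | inr c => fun=> h c end)
    (carrier_inhabited N).

Lemma eval_lift S (M N : algebra S) (h : M -> N) (v : nat -> N) t :
  eval (A := expand h) v (lift_term M t) = eval v t.
Proof.
elim: t => [//|f a IH] /=; congr op.
by apply/funext => i; exact: IH.
Qed.

Lemma sat_lift S (M N : algebra S) (h : M -> N) phi (v : nat -> N) :
  sat (A := expand h) v (lift_formula M phi) <-> sat v phi.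
Proof.
elim: phi v => [s t|//|p IHp q IHq|n p IHp] v /=.
- by rewrite !eval_lift.
- by split=> H /IHp /H /IHq.
- by split=> H a; apply/IHp; exact: H.
Qed.

Lemma expand_hom S (M N : algebra S) (h : M -> N) :
  is_hom h -> @is_hom _ (name_elements M) (expand h) h.
Proof. by move=> hh [f|c] a //=; exact: hh. Qed.

(** Embeddings preserve quantifier-free sentences. Two such expansions that disagree on a sentence
    refute completeness. *)
Lemma model_diagram S (M N : algebra S) (h : M -> N) T :
  is_hom h -> injective h -> model T N ->
  model ((lift_formula M @` T) `|` diagram M) (expand h).
Proof.
move=> hh ih TN phi [[psi Tpsi <-]|[sphi qphi Mphi]] v.
  by apply/sat_lift; exact: TN.
have [x] := carrier_inhabited M.
apply: (@sat_sentence _ (expand h) phi (h \o (fun=> x))) => //.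
apply/(sat_embedding (A := name_elements M) (B := expand h) (fun=> x)
  (expand_hom hh) ih qphi).
exact: Mphi.
Qed.

(** Variable 0 is kept for quantification, the others become constants. The [fun=> Var 0] is a
    dummy, as constants have arity 0. *)
Fixpoint inst_term S C (w : nat -> C) (t : term S) :
    term (add_constants S C) :=
  match t with
  | Var n => if n == 0 then Var 0 else @App (add_constants S C) (inr (w n))
                                         (fun=> Var 0)
  | App f a => @App (add_constants S C) (inl f) (fun i => inst_term w (a i))
  end.

(* Meaningful only when variable 0 is the only variable bound in [phi]. *)
Fixpoint inst S C (w : nat -> C) (phi : formula S) :
    formula (add_constants S C) :=
  match phi with
  | FEq s t => FEq (inst_term w s) (inst_term w t)
  | FBot => FBot
  | FImp phi1 phi2 => FImp (inst w phi1) (inst w phi2)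
  | FAll n phi1 => FAll n (inst w phi1)
  end.

Lemma eval_inst S (M N : algebra S) (h : M -> N) (w : nat -> M)
    (v : nat -> N) t :
  eval (A := expand h) v (inst_term w t) =
  eval (fun n => if n == 0 then v 0 else h (w n)) t.
Proof.
elim: t => [n|f a IH] /=; first by case: (n == 0).
by congr op; apply/funext => i; exact: IH.
Qed.

Lemma sat_inst S (M N : algebra S) (h : M -> N) (w : nat -> M) phi
    (v : nat -> N) : quantifier_free phi ->
  sat (A := expand h) v (inst w phi) <->
  sat (fun n => if n == 0 then v 0 else h (w n)) phi.
Proof.
elim: phi => [s t|//|p IHp q IHq|//] /=; first by rewrite !eval_inst.
by move=> [/IHp hp /IHq hq]; split=> H /hp /H /hq.
Qed.

Lemma inst_term_vars S C (w : nat -> C) (t : term S) :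
  term_vars (inst_term w t) `<=` [set 0].
Proof.
elim: t => [n|f a IH] /=; last by move=> n [i _ /IH].
by case: (n == 0) => //= m [[]].
Qed.

Lemma inst_free_vars S C (w : nat -> C) (phi : formula S) :
  quantifier_free phi -> free_vars (inst w phi) `<=` [set 0].
Proof.
elim: phi => [s t|_ n []|p IHp q IHq|//] /=.
  by move=> _ n [] /inst_term_vars.
by move=> [/IHp sp /IHq sq] n [/sp|/sq].
Qed.

Definition no_fixpoint : formula lattice_signature :=
  FImp (FEq (bin_term Meet (Var 1) (Var 0)) (Var 1))
    (FImp (FEq (bin_term Meet (Var 0) (Var 2)) (Var 0))
      (FImp (FEq (step_term (Var 0)) (Var 0)) FBot)).

Lemma sat_no_fixpoint (A : algebra lattice_signature) (v : nat -> A) :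
  sat v no_fixpoint <-> ~ fixpoint_val v.
Proof.
rewrite -[sat _ _]/(eval v (bin_term Meet (Var 1) (Var 0)) = v 1 ->
  eval v (bin_term Meet (Var 0) (Var 2)) = v 0 ->
  eval v (step_term (Var 0)) = v 0 -> False) eval_step 2!eval_bin.
by split=> [H [? ? ?]|H ? ? ?]; apply: H.
Qed.

Theorem lattices_no_model_completion :
  ~ has_model_completion (theory_of lattices).
Proof.
have [U [UU Uk]] := nonprincipal_ultrafilter.
have [L [a [b [c [z [LL descL]]]]]] := descending_lattice.
case=> T [_ subT embT complT].
have TL A : model T A -> lattices A.
  by move=> TA; apply/model_theory_lattices => phi /subT; exact: TA.
have [N [TN [h0 [hh0 ih0]]]] := embT L ((model_theory_lattices L).2 LL).
pose u := limit_val (h0 a) (h0 b) (h0 c) (h0 z) U.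
(* By Los's theorem the ultrapower is again a model of [T], so it serves both as a model with a
   diagram and as one of the two expansions. *)
have TU : model T (ultrapower N U).
  move=> phi Tphi v.
  have -> : v = fun m => uclass U (quot_repr (v m)).
    by apply/funext => m; rewrite /uclass quot_reprK.
  apply/los; apply: filterS filterT => n _; exact: TN.
have [M [h [v [LM hh ih [fv vE]]]]] :=
  limit_extension (h0 a) (h0 b) (h0 c) (h0 z) (TL _ TN) UU Uk.
(* [M] has the fixpoint but may fail to be a model of [T]; a further extension is one and keeps the
   fixpoint. *)
have [N' [TN' [h' [hh' ih']]]] := embT M ((model_theory_lattices M).2 LM).
have hh'h := comp_hom hh hh'.
have qf : quantifier_free no_fixpoint by [].
have [||H|H] := complT (ultrapower N U) _ (FAll 0 (inst u no_fixpoint)).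
- by apply/model_theory_lattices; exact: TL.
- apply/seteqP; split=> // n [pn]; apply; exact: inst_free_vars qf n pn.
(* Nonexistence of a fixpoint is not a consequence, since [N'] has one. *)
- have := H _ (model_diagram hh'h (inj_comp ih' ih) TN') (fun=> h' (v 0)) (h' (v 0)).
  move=> /(@sat_inst _ _ _ (h' \o h) _ _ _ qf) /sat_no_fixpoint; apply.
  rewrite (_ : (fun n => _) = h' \o v); first exact: fixpoint_val_hom.
  by apply/funext => -[|m] //=; rewrite vE.
(* Its negation is no consequence either: in the ultrapower itself a fixpoint would, at some index
   [n], lie between the iterate [n] and the iterate [n.+1]. *)
- have ultra_hom : is_hom (@idfun (ultrapower N U)) by [].
  have := H _ (model_diagram ultra_hom (@inj_id _) TU) u; apply=> x.
  apply/(@sat_inst _ _ _ idfun _ _ _ qf).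
  have : sat u (FAll 0 no_fixpoint).
    apply/los; apply: filterS filterT => n _ y; apply/sat_no_fixpoint => fy.
    have := fixpoint_val_below n.+1 (TL _ TN) fy.
    rewrite satisfies_below_iterate => y_below.
    apply: (descL n); apply: (le_of_hom hh0 ih0).
    by rewrite !(iter_step_hom _ _ _ _ _ hh0).
  rewrite (_ : (fun m => _) = update u 0 x); first exact.
  by apply/funext => -[].
Qed.

(** * Coherence *)

Definition term_algebra S : algebra S :=
  @Algebra S (term S) (@App S) (inhabits (Var 0)).

Lemma eval_Var S (t : term S) : eval (A := term_algebra S) Var t = t.
Proof. by elim: t => [//|f a IH] /=; congr App; apply/funext. Qed.

(** Terms have infinitely many variables; [inord] sends those beyond [n] to generator 0, so that the
    quotient has just [n.+1] free generators. *)
Definition lattice_identity n :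
    set (term_algebra lattice_signature * term_algebra lattice_signature) :=
  [set p | forall (A : algebra lattice_signature) (v : 'I_n.+1 -> A),
     lattices A -> eval (v \o inord) p.1 = eval (v \o inord) p.2].

Lemma lattice_identity_congruence n : congruence (@lattice_identity n).
Proof.
split=> [//|s t st A v LA|s t r st tr A v LA|f s t st A v LA] /=.
- by rewrite (st A v LA).
- by rewrite (st A v LA); exact: tr.
- by congr op; apply/funext => i; exact: st.
Qed.

Definition free_lattice n : algebra lattice_signature :=
  quotient_algebra (@lattice_identity n).

Definition free_gen n (i : 'I_n.+1) : free_lattice n :=
  quot_class _ (Var i : term_algebra lattice_signature).

Lemma free_lattice_lattice n : lattices (free_lattice n).
Proof.
pose cl (t : term_algebra lattice_signature) : free_lattice n :=
  quot_class _ t.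
have ct := @lattice_identity_congruence n.
have E s t1 t2 : binary s (cl t1) (cl t2) = cl (bin_term s t1 t2).
  by rewrite -(hom_binary _ _ _ (quot_class_hom ct)).
have K X : exists t, cl t = X by exists (quot_repr X); exact: quot_reprK.
split; [split|split|split|idtac|idtac].
- move=> X Y; have [[s <-] [t <-]] := (K X, K Y); rewrite !E.
  by apply/quot_classE => // A v [[mC _] _ _ _ _]; rewrite !eval_bin mC.
- move=> X Y; have [[s <-] [t <-]] := (K X, K Y); rewrite !E.
  by apply/quot_classE => // A v [[_ jC] _ _ _ _]; rewrite !eval_bin jC.
- move=> X Y Z; have [[s <-] [t <-] [r <-]] := And3 (K X) (K Y) (K Z).
  rewrite !E; apply/quot_classE => // A v [_ [mA _] _ _ _].
  by rewrite !eval_bin mA.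
- move=> X Y Z; have [[s <-] [t <-] [r <-]] := And3 (K X) (K Y) (K Z).
  rewrite !E; apply/quot_classE => // A v [_ [_ jA] _ _ _].
  by rewrite !eval_bin jA.
- move=> X; have [s <-] := K X; rewrite !E.
  by apply/quot_classE => // A v [_ _ [mm _] _ _]; rewrite !eval_bin mm.
- move=> X; have [s <-] := K X; rewrite !E.
  by apply/quot_classE => // A v [_ _ [_ jj] _ _]; rewrite !eval_bin jj.
- move=> X Y; have [[s <-] [t <-]] := (K X, K Y); rewrite !E.
  by apply/quot_classE => // A v [_ _ _ mj _]; rewrite !eval_bin mj.
- move=> X Y; have [[s <-] [t <-]] := (K X, K Y); rewrite !E.
  by apply/quot_classE => // A v [_ _ _ _ jm]; rewrite !eval_bin jm.
Qed.

Lemma free_lattice_on n : free_on lattices (@free_gen n).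
Proof.
split=> [|A v LA]; first exact: free_lattice_lattice.
have ct := @lattice_identity_congruence n.
pose ev (t : term_algebra lattice_signature) : A := eval (v \o inord) t.
have hev : is_hom ev by [].
have [k [hk kE]] := hom_factor ct hev (fun s t st => st A v LA).
have clE (i : nat) : quot_class (@lattice_identity n)
    (Var i : term_algebra lattice_signature) = free_gen (inord i).
  by apply/quot_classE => // B w _ /=; rewrite inord_val.
exists k; split=> [|k' [hk' k'E]].
  split=> //; apply/funext => i /=.
  by rewrite /free_gen kE /ev /= inord_val.
(* A class is the value of its representative at the generators, so [k'] is determined by its values
   there. *)
apply/funext => X; rewrite -(quot_reprK X) kE -[in RHS](eval_Var (quot_repr X)).
have hq := comp_hom (quot_class_hom ct) hk'.
rewrite [RHS](eval_hom _ _ hq); congr eval; apply/funext => i /=.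
by rewrite clE -[v _]/((v \o inord) i) -k'E.
Qed.

(** * Generated subalgebras *)

Lemma inverse_hom S (A B : algebra S) (h : A -> B) (k : B -> A) :
  is_hom h -> cancel h k -> cancel k h -> is_hom k.
Proof.
move=> hh hK kK f b; rewrite -[LHS]/(k (op B f b)).
rewrite (_ : op B f b = h (op A f (k \o b))) ?hK // hh.
by congr op; apply/funext => i /=; rewrite kK.
Qed.

Lemma smallest_op_closed S (A : algebra S) (G : set A) :
  op_closed (smallest (@op_closed S A) G).
Proof.
by move=> f a Ga M [Mc GM]; apply: (Mc) => i; exact: Ga i M (conj Mc GM).
Qed.

Lemma smallest_op_closed_eval S (A : algebra S) (G : set A) (v : nat -> A) x :
  G `<=` range v -> smallest (@op_closed S A) G x ->
  exists t, x = eval v t.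
Proof.
move=> Gv /(_ [set x | exists t, x = eval v t]); apply; split.
  move=> f a /choice[t at_]; exists (App t) => /=.
  by congr op; apply/funext.
by move=> y /Gv[n _ <-]; exists (Var n).
Qed.

Lemma sval_hom S (A : algebra S) (B : subalgebra A) :
  @is_hom S (algebra_of_sub B) A (fun x => sval x).
Proof. by []. Qed.

(** [A] is presented by the system and [B] is its subalgebra generated by [y, z, a, b, c]. If [B]
    had a finite presentation, its finitely many relations would hold in [L] under the valuation
    [iterate_val] at some index [n]. The resulting homomorphism from [B] to [L] would carry
    [y <= step^(n+1) z] to an inequality that fails in [L]. *)
Theorem lattices_not_coherent : ~ coherent lattices.
Proof.
move=> coh.
have [U [UU Uk]] := nonprincipal_ultrafilter.
have FU : Filter U by exact: ultra_proper.
have [L [a [b [c [z [LL descL]]]]]] := descending_lattice.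
have [M [h [v [LM hh ih [fv vE]]]]] := limit_extension a b c z LL UU Uk.
pose u := limit_val a b c z U.
have [LF freeF] := free_lattice_on 5.
pose gv m : free_lattice 5 := free_gen (inord m).
pose R := [set (eval gv e.1, eval gv e.2) | e in fixpoint_eqs].
pose theta := smallest (@congruence _ (free_lattice 5)) R.
have ct : congruence theta by exact: smallest_congruence.
pose A := quotient_algebra theta.
have hcl := quot_class_hom ct.
have LA : lattices A.
  apply: lattices_image hcl _ LF => X.
  by exists (quot_repr X); exact: quot_reprK.
have fpA : finitely_presented lattices A.
  exists 6, (free_lattice 5), (@free_gen 5), theta; split.
  - exact: free_lattice_on.
  - exists R; split=> //; apply: finite_image.
    by rewrite /fixpoint_eqs; do ?[rewrite finite_setU; split].
  - by exists id; split=> //; exists id.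
pose xA : nat -> A := quot_class theta \o gv.
have fxA : fixpoint_val xA.
  apply/fixpoint_eqsP => e fe; rewrite /satisfies_eq -!(eval_hom _ _ hcl).
  by apply/quot_classE => //; apply: sub_gen_smallest; exists e.
(* [r] redirects the variable x, which is not among the generators of the
   subalgebra, to y. *)
pose r (j : nat) := if j == 0 then 1 else minn j 5.
have r_gt0 j : r j != 0 by rewrite /r; case: j => // j; rewrite minnSS.
have r_lt6 j : r j < 6 by rewrite /r; case: j => // j; rewrite ltnS geq_minr.
pose vA := xA \o r.
pose G := vA @` `I_6.
have vAG j : G (vA j).
  exists (r j) => //=; rewrite /vA /=; congr xA; rewrite /r.
  by case: j => // -[|[|[|[|[|j]]]]].
have GBnonempty : smallest (@op_closed _ A) G !=set0.
  by exists (vA 0); exact: sub_gen_smallest.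
pose B := Subalgebra (@smallest_op_closed _ A G) GBnonempty.
have [|m [F' [g' [theta' [[_ freeF'] [R' [finR' theta'E]] [J [hJ [K JK KJ]]]]]]]] :=
  coh A LA fpA B.
  by exists G; split=> //; exact: finite_image (finite_II 6).
have ct' : congruence theta' by rewrite theta'E; exact: smallest_congruence.
have hK : is_hom K := inverse_hom hJ JK KJ.
pose pi p : algebra_of_sub B := K (quot_class theta' p).
have hpi : is_hom pi := comp_hom (quot_class_hom ct') hK.
pose vB j : algebra_of_sub B := exist _ (vA j) (sub_gen_smallest (vAG j)).
pose f j := quot_repr (J (vB j)).
have fE j : pi (f j) = vB j by rewrite /pi quot_reprK.
(* Each generator of the presentation of [B] is written as a term in [y, z, a, b, c]; [hn n] then
   evaluates these terms in [L] at index [n]. *)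
have /choice[s sE] i : exists t, sval (pi (g' i)) = eval vA t.
  apply: smallest_op_closed_eval (svalP (pi (g' i))).
  by move=> _ [j _ <-]; exists j.
have /choice[hn hnE] n : exists k : F' -> L, is_hom k /\
    forall i, k (g' i) = eval (iterate_val a b c z n) (s i).
  have [k [[hk kE] _]] :=
    freeF' L (fun i => eval (iterate_val a b c z n) (s i)) LL.
  by exists k; split=> // i; rewrite -[LHS]/((k \o g') i) kE.
pose hU p : ultrapower L U := uclass U (hn ^~ p).
have hhU : is_hom hU by apply: uclass_hom => n; exact: (hnE n).1.
have [k0 [[hk0 k0E] _]] := freeF M (fun i => v i) LM.
have k0v j : j < 6 -> k0 (gv j) = v j.
  by move=> j6; rewrite -[LHS]/((k0 \o @free_gen 5) _) k0E inordK.
have [H [hH HE]] : exists H : A -> M,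
    is_hom H /\ forall p, H (quot_class theta p) = k0 p.
  apply: hom_factor => //; apply: smallest_congruence_ker => // _ [e fe <-] /=.
  rewrite !(eval_hom _ _ hk0); apply: (fixpoint_eqsP _).2 fe.
  by rewrite /fixpoint_val /= !k0v.
(* [v] and [h \o u] agree off variable 0, which [r] avoids; at 0 both sides are the value of [y],
   and beyond 5 that of [c]. *)
have HvA : H \o vA = h \o u.
  apply/funext => j; rewrite /vA /= HE k0v // vE //; congr h.
  rewrite /u /limit_val; congr uclass; apply/funext => n.
  by rewrite /iterate_val /assign /r; case: j => // -[|[|[|[|[|j]]]]].
(* Both sides are homomorphisms in [p] that agree on the generators of [F'], so freeness identifies
   them. *)
have HhU p : H (sval (pi p)) = h (hU p).
  have [k [_ ku]] := freeF' M (fun i => h (hU (g' i))) LM.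
  have hHpi := comp_hom (comp_hom hpi (@sval_hom _ A B)) hH.
  have E1 := ku _ (conj (comp_hom hhU hh) erefl).
  suff E2 : k = H \o ((fun x => sval x) \o pi).
    by rewrite -[RHS]/((h \o hU) p) -E1 E2.
  apply: ku; split=> //; apply/funext => i /=.
  rewrite sE (eval_hom _ _ hH) HvA -(eval_hom _ _ hh); congr h.
  rewrite eval_ultrapower; congr uclass; apply/funext => n.
  by rewrite (hnE n).2.
(* A relation of [R'] holds in [B], hence in [M], hence in the ultrapower by injectivity of [h],
   hence at almost all indices. *)
have UR' : U [set n | forall p, R' p -> hn n p.1 = hn n p.2].
  apply: filter_finite_set => // -[p q] R'pq.
  apply/uclassE; apply: ih; rewrite -!HhU /pi.
  suff -> : quot_class theta' p = quot_class theta' q by [].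
  by apply/quot_classE => //; rewrite theta'E; exact: sub_gen_smallest.
(* Almost everywhere [hn n] also sends the chosen representatives of the generators of [B] to the
   intended values. *)
have Uf : U [set n | forall j, `I_6 j ->
    hn n (f j) = iterate_val a b c z n j].
  apply: filter_finite_set => // j _; apply/uclassE; apply: ih.
  by rewrite -[X in h X]/(hU (f j)) -HhU fE -[LHS]/((H \o vA) j) HvA.
have [n [nR' nf]] := filter_ex (filterI UR' Uf).
have [k [hk kE]] : exists k : quotient_algebra theta' -> L,
    is_hom k /\ forall p, k (quot_class theta' p) = hn n p.
  apply: hom_factor => //; first exact: (hnE n).1.
  by rewrite theta'E; apply: smallest_congruence_ker => //; exact: (hnE n).1.
have kJ j : j < 6 -> k (J (vB j)) = iterate_val a b c z n j.
  by move=> j6; rewrite -fE /pi KJ kE nf.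
(* In [A] the fixpoint forces this inequality; it does not involve [x], so it already holds in
   [B]. *)
have vB_below : satisfies_eq vB (below_iterate n.+1).
  apply: sval_inj; rewrite !(eval_hom _ _ (@sval_hom _ A B)).
  rewrite -[_ = _]/(satisfies_eq vA (below_iterate n.+1)).
  have := fixpoint_val_below n.+1 LA fxA.
  by rewrite !satisfies_below_iterate.
have := satisfies_hom (comp_hom hJ hk) vB_below.
rewrite satisfies_below_iterate /= !kJ //; exact: descL.
Qed.

Theorem corollary5p14 :
  ~ coherent lattices /\
  ~ right_uniform_deductive_interpolation lattices /\
  ~ has_model_completion (theory_of lattices).
Proof.
split; first exact: lattices_not_coherent.
by split; [exact: lattices_no_right_uniform_interpolation|exact: lattices_no_model_completion].
Qed.
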